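(* For a pair $x=(L,U)$ of predicates on the rationals: (1) there is a function $\operatorname{isCut}^S(x)\to\operatorname{isDedekindCut}(x)$; (2) $\|\operatorname{isCut}^S(x)\|\Rightarrow\operatorname{isDedekindCut}(x)$; (3) there is a function $\operatorname{isDedekindCut}(x)\times\operatorname{locator}(x)\to\operatorname{isCut}^S(x)$; (4) $\operatorname{isDedekindCut}(x)\land\|\operatorname{locator}(x)\|\Rightarrow\operatorname{isCauchyReal}(x)$; (5) $\|\operatorname{isCut}^S(x)\|\Rightarrow\operatorname{isCauchyReal}(x)$.
   Context: Work in Martin-Löf type theory with propositional truncation $\|\cdot\|$, function extensionality and propositional extensionality; $\land,\lor,\exists$ are truncated ($P\lor Q=\|P+Q\|$, $\exists=\|\Sigma\|$). For $L,U$ proposition-valued predicates on $\mathbb{Q}$ write $q<x$ for $q\in L$, $x<r$ for $r\in U$. $\operatorname{isDedekindCut}(x)$ is the conjunction of: $\exists q.\,q<x$; $\exists r.\,x<r$; $\forall q,q'.\,(q<q')\land(q'<x)\Rightarrow q<x$; $\forall r,r'.\,(r'<r)\land(x<r')\Rightarrow x<r$; $\forall q.\,q<x\Rightarrow\exists q'.\,(q<q')\land(q'<x)$; $\forall r.\,x<r\Rightarrow\exists r'.\,(r'<r)\land(x<r')$; $\forall q,r.\,(q<x)\land(x<r)\Rightarrow q<r$; $\forall q,r.\,(q<r)\Rightarrow(q<x)\lor(x<r)$. $\operatorname{isCut}^S(x)$ is the (untruncated) product of: $\sum_{q}q<x$; $\sum_r x<r$; $\prod_{q,q'}(q<q')\times(q'<x)\to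 q<x$; $\prod_{r,r'}(r'<r)\times(x<r')\to x<r$; $\prod_q (q<x)\to\sum_{q'}(q<q')\times(q'<x)$; $\prod_r(x<r)\to\sum_{r'}(r'<r)\times(x<r')$; $\prod_{q,r}(q<x)\times(x<r)\to q<r$; and $\operatorname{locator}(x):=\prod_{q,r:\mathbb{Q}}(q<r)\to(q<x)+(x<r)$ (untruncated sum). $\operatorname{isCauchyReal}(x)$ means that $x$ is a Dedekind cut which lies in the image of the canonical inclusion of the Cauchy reals into the Dedekind reals, equivalently that there exists a Cauchy sequence of rationals (with modulus of convergence) whose limit is $x$. *)

(* Defs.v *)
(* Propositions are the inhabitants of [Prop]: [/\], [\/], [exists] are the
   truncated connectives, and [inhabited T : Prop] is the propositional
   truncation of [T : Type].  Untruncated structure uses [*], [sig], [sumbool],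
   which live in [Type] and can be eliminated to produce data. *)
From mathcomp Require Import all_boot all_order all_algebra.
From mathcomp Require Import lra.

Set Implicit Arguments.
Unset Strict Implicit.
Unset Printing Implicit Defensive.

Import Order.TTheory GRing.Theory Num.Theory.
Local Open Scope ring_scope.

(* x = (L, U), with no conditions on L and U. *)
Definition predPair : Type := ((rat -> Prop) * (rat -> Prop))%type.

(* q < x *)
Definition ltL (q : rat) (x : predPair) : Prop := x.1 q.
(* x < r *)
Definition ltU (x : predPair) (r : rat) : Prop := x.2 r.

Record isDedekindCut (x : predPair) : Prop := IsDedekindCut {
  dc_bounded_lower : exists q, ltL q x;
  dc_bounded_upper : exists r, ltU x r;
  dc_closed_lower : forall q q', q < q' /\ ltL q' x -> ltL q x;
  dc_closed_upper : forall r r', r' < r /\ ltU x r' -> ltU x r;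
  dc_open_lower : forall q, ltL q x -> exists q', q < q' /\ ltL q' x;
  dc_open_upper : forall r, ltU x r -> exists r', r' < r /\ ltU x r';
  dc_transitive : forall q r, ltL q x /\ ltU x r -> q < r;
  dc_located : forall q r, q < r -> ltL q x \/ ltU x r
}.

Definition locator (x : predPair) : Type :=
  forall q r : rat, q < r -> {ltL q x} + {ltU x r}.

Record isCutS (x : predPair) : Type := IsCutS {
  cs_bounded_lower : {q : rat | ltL q x};
  cs_bounded_upper : {r : rat | ltU x r};
  cs_closed_lower : forall q q', q < q' /\ ltL q' x -> ltL q x;
  cs_closed_upper : forall r r', r' < r /\ ltU x r' -> ltU x r;
  cs_open_lower : forall q, ltL q x -> {q' : rat | q < q' /\ ltL q' x};
  cs_open_upper : forall r, ltU x r -> {r' : rat | r' < r /\ ltU x r'};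
  cs_transitive : forall q r, ltL q x /\ ltU x r -> q < r;
  cs_locator : locator x
}.

(* Only the values of the modulus [M] at positive rationals matter. *)
Definition cauchy_modulus (s : nat -> rat) (M : rat -> nat) : Prop :=
  forall e : rat, 0 < e ->
  forall m n : nat, (M e <= m)%N -> (M e <= n)%N -> `|s m - s n| < e.

(* [s n - e < x] and [x < s n + e] together express |x - s n| < e. *)
Definition is_limit (s : nat -> rat) (x : predPair) : Prop :=
  forall e : rat, 0 < e ->
  exists N : nat, forall n : nat, (N <= n)%N ->
    ltL (s n - e) x /\ ltU x (s n + e).

Definition isCauchyReal (x : predPair) : Prop :=
  isDedekindCut x /\
  exists (s : nat -> rat) (M : rat -> nat), cauchy_modulus s M /\ is_limit s x.

(* The canonical inclusion of the Cauchy reals, on representatives. *)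
Definition cauchy_cut (s : nat -> rat) (M : rat -> nat) : predPair :=
  (fun q => exists e : rat, 0 < e /\ q + e < s (M e),
   fun r => exists e : rat, 0 < e /\ s (M e) + e < r).

(* Equality of pairs of predicates, up to extensionality. *)
Definition predPair_eq (x y : predPair) : Prop :=
  (forall q, ltL q x <-> ltL q y) /\ (forall r, ltU x r <-> ltU y r).

Lemma isCauchyReal_image (x : predPair) :
  isCauchyReal x <->
  isDedekindCut x /\
  exists (s : nat -> rat) (M : rat -> nat),
    cauchy_modulus s M /\ predPair_eq x (cauchy_cut s M).
Proof.
split=> -[Dx [s [M [sM xs]]]]; split=> //; exists s, M; split=> //.
- have near e : 0 < e ->
    forall d, 0 < d -> ltL (s (M e) - e - d) x /\ ltU x (s (M e) + e + d).
    move=> e0 d d0; have [N HN] := xs d d0.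
    have [] := HN (maxn N (M e)) (leq_maxl _ _).
    have := sM e e0 _ _ (leq_maxr N (M e)) (leqnn (M e)).
    rewrite ltr_norml => /andP[h1 h2] hl hu; split.
      by apply: (dc_closed_lower Dx) (conj _ hl); lra.
    by apply: (dc_closed_upper Dx) (conj _ hu); lra.
  split=> [q|r]; split.
  + move=> /(dc_open_lower Dx)[q' [qq' q'x]].
    exists ((q' - q) / 3); split; first lra.
    have e0 : 0 < (q' - q) / 3 by lra.
    have [_ hu] := near _ e0 _ e0.
    have := dc_transitive Dx (conj q'x hu); lra.
  + case=> e [e0 qe]; have [hl _] := near e e0 ((s (M e) - e - q) / 2) ltac:(lra).
    by apply: (dc_closed_lower Dx) (conj _ hl); lra.
  + move=> /(dc_open_upper Dx)[r' [rr' r'x]].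
    exists ((r - r') / 3); split; first lra.
    have e0 : 0 < (r - r') / 3 by lra.
    have [hl _] := near _ e0 _ e0.
    have := dc_transitive Dx (conj hl r'x); lra.
  + case=> e [e0 qe]; have [_ hu] := near e e0 ((r - s (M e) - e) / 2) ltac:(lra).
    by apply: (dc_closed_upper Dx) (conj _ hu); lra.
- case: xs => xl xu e e0.
  have e3 : 0 < e / 3 by lra.
  exists (M (e / 3)) => n Hn.
  have := sM _ e3 _ _ Hn (leqnn _); rewrite ltr_norml => /andP[h1 h2].
  split; [apply/xl|apply/xu]; exists (e / 3); split=> //; lra.
Qed.

(* Main.v *)
(** A locator decides, for each rational [t], between a property [A t] of [x]
    and a property [B t] incompatible with a slightly stronger form of [A t].
    So if some [t] satisfies the stronger form, hence not [B t], then
    enumerating the rationals until the locator answers [A] produces a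
    definite witness. All the data of [isCutS], as well as rational
    approximations to any given precision, are extracted from their truncated
    versions in this way; the approximations within [1 / (n + 1)] then form a
    Cauchy sequence that converges to [x]. *)
Require Import Defs.
From mathcomp Require Import all_boot all_order all_algebra.
From mathcomp Require Import lra.

Set Implicit Arguments.
Unset Strict Implicit.
Unset Printing Implicit Defensive.

Import Order.TTheory GRing.Theory Num.Theory.
Local Open Scope ring_scope.

(** The answer of [dec] is a boolean predicate on a [choiceType], so [xchoose] turns its mere
    satisfiability into a witness. *)
Lemma sumbool_search (T : choiceType) (A B : T -> Prop) :
  (forall t, {A t} + {B t}) -> (exists t, ~ B t) -> {t | A t}.
Proof.
move=> dec exB; have exA : exists t, (dec t : bool).
  by case: exB => t nBt; exists t; case: (dec t).
by exists (xchoose exA); have := xchooseP exA; case: (dec _).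
Qed.

Lemma isCutS_isDedekindCut (x : predPair) : isCutS x -> isDedekindCut x.
Proof.
case=> -[q0 lq0] [r0 ur0] cl cu ol ou tr loc; split=> //.
- by exists q0.
- by exists r0.
- by move=> q /ol[q' ?]; exists q'.
- by move=> r /ou[r' ?]; exists r'.
- by move=> q r /loc[]; [left | right].
Qed.

Section LocatedCut.

Variables (x : predPair) (Dx : isDedekindCut x).

Lemma ltLU_irrefl q : ltL q x -> ltU x q -> False.
Proof. by move=> lq uq; have := dc_transitive Dx (conj lq uq); rewrite ltxx. Qed.

(** Walk upwards from a lower bound [q] in steps of [e], by induction on the number of steps that
    suffices to pass the upper bound [r]. *)
Lemma exists_approx (e : rat) :
  0 < e -> exists p, ltL (p - e) x /\ ltU x (p + e).
Proof.
move=> e0; have [q lq] := dc_bounded_lower Dx.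
have [r ur] := dc_bounded_upper Dx.
have : exists N : nat, r - q < N.+1%:R * e.
  exists (Num.truncn ((r - q) / e)).
  by rewrite -ltr_pdivrMr // truncnS_gt.
case=> N; elim: N q lq => [|N IHN] q lq rq.
  exists q; split; first by apply: (dc_closed_lower Dx) (conj _ lq); lra.
  by apply: (dc_closed_upper Dx) (conj _ ur); lra.
(* Either [q + e] is below [x] and the walk goes on from there, or [x] lies between [q] and
   [q + e + e] and the midpoint [q + e] is the approximation. *)
have [||uq] := dc_located Dx (_ : q + e < q + e + e); first by lra.
  by move=> /IHN; apply; move: rq; rewrite -(natr1 N.+1); lra.
by exists (q + e); rewrite addrK.
Qed.

Variable loc : locator x.

Lemma locator_bounded_lower : {q : rat | ltL q x}.
Proof.
apply: (@sumbool_search _ _ (fun q => ltU x (q + 1))) => [q|].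
  by apply: loc; lra.
have [q lq] := dc_bounded_lower Dx.
by exists (q - 1); rewrite subrK; apply: ltLU_irrefl.
Qed.

Lemma locator_bounded_upper : {r : rat | ltU x r}.
Proof.
apply: (@sumbool_search _ _ (fun r => ltL (r - 1) x)) => [r|].
  by have [|lr|ur] := loc (_ : r - 1 < r); [lra|right|left].
have [r ur] := dc_bounded_upper Dx.
by exists (r + 1); rewrite addrK => /ltLU_irrefl.
Qed.

Lemma locator_open_lower q : ltL q x -> {q' : rat | q < q' /\ ltL q' x}.
Proof.
move=> lq.
(* The point [t + (t - q)] mirrors [q] in [t]; when [t] is the midpoint of [q] and some [q'] below
   [x], it is [q'], which refutes the alternative. *)
apply: (@sumbool_search _ _ (fun t => t <= q \/ ltU x (t + (t - q)))) => [t|].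
  have [tq|qt] := leP t q; first by right; left.
  by have [|lt|ut] := loc (_ : t < t + (t - q)); [lra|left|right; right].
have [q' [qq' lq']] := dc_open_lower Dx lq.
exists ((q + q') / 2) => -[|]; first lra.
have -> : (q + q') / 2 + ((q + q') / 2 - q) = q' by lra.
exact: ltLU_irrefl.
Qed.

Lemma locator_open_upper r : ltU x r -> {r' : rat | r' < r /\ ltU x r'}.
Proof.
move=> ur.
apply: (@sumbool_search _ _ (fun t => r <= t \/ ltL (t - (r - t)) x)) => [t|].
  have [rt|tr] := leP r t; first by right; left.
  by have [|lt|ut] := loc (_ : t - (r - t) < t); [lra|right; right|left].
have [r' [rr' ur']] := dc_open_upper Dx ur.
exists ((r + r') / 2) => -[|]; first lra.
have -> : (r + r') / 2 - (r - (r + r') / 2) = r' by lra.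
by move=> /ltLU_irrefl.
Qed.

Lemma locator_isCutS : isCutS x.
Proof.
split=> //.
- exact: locator_bounded_lower.
- exact: locator_bounded_upper.
- exact: dc_closed_lower Dx.
- exact: dc_closed_upper Dx.
- exact: locator_open_lower.
- exact: locator_open_upper.
- exact: dc_transitive Dx.
Qed.

Lemma locator_approx (e : rat) :
  0 < e -> {p : rat | ltL (p - e) x /\ ltU x (p + e)}.
Proof.
move=> e0.
(* The locator is queried on the two outer margins of width [e / 2]; an approximation within [e / 2]
   rules out both bad answers. *)
apply: (@sumbool_search _ _
  (fun p => ltU x (p - e / 2) \/ ltL (p + e / 2) x)) => [p|].
  have [|lp|up] := loc (_ : p - e < p - e / 2); [lra| |by right; left].
  have [|lp'|up] := loc (_ : p + e / 2 < p + e); [lra|by right; right|].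
  by left.
have [|p [lp up]] := @exists_approx (e / 2); first by lra.
by exists p => -[/(ltLU_irrefl lp)|/ltLU_irrefl/(_ up)].
Qed.

Lemma locator_isCauchyReal : isCauchyReal x.
Proof.
split=> //; pose d n : rat := n.+1%:R^-1.
have d0 n : 0 < d n by rewrite invr_gt0 ltr0n.
have d_le m n : (m <= n)%N -> d n <= d m.
  by move=> mn; rewrite lef_pV2 ?posrE ?ltr0n // ler_nat.
pose s n := sval (locator_approx (d0 n)).
have sP n : ltL (s n - d n) x /\ ltU x (s n + d n).
  exact: (svalP (locator_approx (d0 n))).
(* Terms [s m] and [s n] differ by less than [d m + d n], which is at most [2 * d (M e)] once both
   indices reach [M e]. *)
pose M (e : rat) := Num.truncn (2 / e).
have dM e : 0 < e -> 2 * d (M e) < e.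
  move=> e0; rewrite ltr_pdivrMr ?ltr0n // mulrC -ltr_pdivrMr //.
  exact: truncnS_gt.
exists s, M; split=> [e e0 m n Mm Mn|e e0].
  have [lm um] := sP m; have [ln un] := sP n.
  have mn := dc_transitive Dx (conj lm un).
  have nm := dc_transitive Dx (conj ln um).
  have := d_le _ _ Mm; have := d_le _ _ Mn; have := dM e e0.
  by move=> h1 h2 h3; rewrite ltr_norml; apply/andP; split; lra.
exists (M e) => n Mn; have [ln un] := sP n.
have := dM e e0; have := d_le _ _ Mn; have := d0 n => h1 h2 h3; split.
  by apply: (dc_closed_lower Dx) (conj _ ln); lra.
by apply: (dc_closed_upper Dx) (conj _ un); lra.
Qed.

End LocatedCut.

Theorem theorem3p44 (x : predPair) :
  ((isCutS x -> isDedekindCut x) *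
   (inhabited (isCutS x) -> isDedekindCut x) *
   (isDedekindCut x * locator x -> isCutS x) *
   (isDedekindCut x /\ inhabited (locator x) -> isCauchyReal x) *
   (inhabited (isCutS x) -> isCauchyReal x))%type.
Proof.
split; [split; [split; [split|]|]|].
- exact: isCutS_isDedekindCut.
- by case; apply: isCutS_isDedekindCut.
- by case; apply: locator_isCutS.
- by case=> Dx [loc]; apply: locator_isCauchyReal.
- case=> Sx; apply: locator_isCauchyReal (cs_locator Sx).
  exact: isCutS_isDedekindCut.
Qed.
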